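(* Let $\mathcal H$ be a separable Hilbert space, let $A$ and $K$ be bounded self-adjoint operators on $\mathcal H$ with $K\ge \mathbf 0$, and let $\sigma$ be an arbitrary singular measure on $\mathbb R$. If $\operatorname{Ran} K$ is cyclic for $A$, then for almost all $t\in\mathbb R$ (with respect to Lebesgue measure) the spectral measure of $A+tK$ (equivalently, its singular part) is mutually singular with $\sigma$.
   Context: Measures on $\mathbb R$ are finite non-negative Borel measures; ''singular'' (and ''singular part'') means singular with respect to Lebesgue measure. Operators are bounded. For a self-adjoint operator $A$ on $\mathcal H$ with projection-valued spectral measure $\mathbf E$, the scalar spectral measure of $\mathbf x\in\mathcal H$ is $\mu_{\mathbf x}(\cdot)=\langle \mathbf E(\cdot)\mathbf x,\mathbf x\rangle$. A vector $\mathbf x$ has maximal spectral type if $\mu_{\mathbf y}\ll\mu_{\mathbf x}$ for every $\mathbf y\in\mathcal H$. ''The spectral measure of $A$'' means a scalar spectral measure of maximal spectral type, i.e. $\mu_{\mathbf x}$ for some $\mathbf x$ of maximal spectral type; it is unique up to mutual absolute continuity. A set $S\subset\mathcal H$ is cyclic for $A$ if the smallest closed $A$-invariant subspace containing $S$ is $\mathcal H$. *)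

(* Defs.v *)
From HB Require Import structures.
From mathcomp Require Import all_boot all_order all_algebra sesquilinear.
From mathcomp Require Import complex.
From mathcomp Require Import all_classical all_reals all_analysis.

Set Implicit Arguments.
Unset Strict Implicit.
Unset Printing Implicit Defensive.

Import Order.TTheory GRing.Theory Num.Theory numFieldNormedType.Exports.

Local Open Scope classical_set_scope.
Local Open Scope ring_scope.
Local Open Scope complex_scope.

(* The inner product is linear in its first argument and conjugate-linear in
   the second one. *)
HB.mixin Record CompleteNormedModule_isHilbert (C : numClosedFieldType) H
    & CompleteNormedModule C H := {
  inner : {dot H for (@Num.conj C : C -> C)};
  sqr_norm_inner : forall x : H, `|x| ^+ 2 = inner x x
}.

#[short(type="hilbertType")]
HB.structure Definition Hilbert (C : numClosedFieldType) :=
  {H of CompleteNormedModule_isHilbert C H & CompleteNormedModule C H}.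

Lemma inner_CauchySchwarz (C : numClosedFieldType) (H : hilbertType C) (x y : H) :
  `|inner x y| <= `|x| * `|y|.
Proof.
have [->|y0] := eqVneq y 0; first by rewrite linear0r !normr0 mulr0.
have a0 : 0 < inner y y by exact: neq0_dnorm_gt0.
rewrite -(@ler_pXn2r _ 2)// ?nnegrE ?mulr_ge0//.
rewrite exprMn !sqr_norm_inner normCK.
set a := inner y y in a0 *; set d := inner x y.
have zy : inner (a *: x - d *: y) y = 0.
  by rewrite linearBl !linearZl_LR/= mulrC subrr.
have : 0 <= inner (a *: x - d *: y) (a *: x - d *: y).
  by rewrite -sqr_norm_inner exprn_ge0.
rewrite linearBr !linearZr_LR /= zy mulr0 subr0.
rewrite linearBl !linearZl_LR/= [inner y x]hermC/= expr0 mul1r.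
rewrite (CrealP (gtr0_real a0)) pmulr_rge0// subr_ge0 mulrC => /le_trans; apply.
by rewrite mulrC.
Qed.

Section operators.
Variables (C : numClosedFieldType) (H : hilbertType C).
Implicit Types T : {linear H -> H}.

Definition bounded_operator T := exists M : C, forall x, `|T x| <= M * `|x|.

Definition self_adjoint T := forall x y, inner (T x) y = inner x (T y).

Definition nonneg_operator T := forall x, 0 <= inner (T x) x.

Definition orthogonal_projection T := (forall x, T (T x) = T x) /\ self_adjoint T.

Definition closed_invariant_subspace T (V : set H) :=
  [/\ V 0, forall (a : C) (x y : H), V x -> V y -> V (a *: x + y),
      closed V & T @` V `<=` V].

Definition cyclic_set T (S : set H) :=
  smallest (closed_invariant_subspace T) S = [set: H].

End operators.

Definition separable_space (T : topologicalType) :=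
  exists2 D : set T, countable D & dense D.

Section spectral_measure.
Context {R : realType} (H : hilbertType R[i]).

(* Only the values on Borel sets are constrained. *)
Record pvm := Pvm {
  pvm_fun :> set (measurableTypeR R) -> {linear H -> H} ;
  pvm_proj : forall B, measurable B -> orthogonal_projection (pvm_fun B) ;
  pvm_set0 : forall x, pvm_fun set0 x = 0 ;
  pvm_setT : forall x, pvm_fun setT x = x ;
  pvm_setI : forall B D, measurable B -> measurable D ->
    forall x, pvm_fun (B `&` D) x = pvm_fun B (pvm_fun D x) ;
  pvm_sigma_additive : forall F : (set (measurableTypeR R))^nat,
    (forall n, measurable (F n)) -> trivIset setT F ->
    forall x, (fun n => \sum_(0 <= k < n) pvm_fun (F k) x) @ \oo -->
              pvm_fun (\bigcup_n F n) x
}.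

(* The junk value 0 off the Borel sets makes this a [measure]. *)
Definition scalar_measure (E : pvm) (x : H) (B : set (measurableTypeR R))
  : \bar R := if `[< measurable B >] then (complex.Re (inner (E B x) x))%:E else 0.

Section scalar_measure_instance.
Variables (E : pvm) (x : H).

Local Notation mu := (scalar_measure E x).

Let muE B : measurable B -> mu B = (complex.Re (inner (E B x) x))%:E.
Proof. by move=> mB; rewrite /scalar_measure asboolT. Qed.

Let mu0 : mu set0 = 0%E.
Proof.
by rewrite muE// pvm_set0 linear0l.
Qed.

Let mu_ge0 B : (0 <= mu B)%E.
Proof.
rewrite /scalar_measure; case: asboolP => // mB; rewrite lee_fin.
have [idemE selfE] := pvm_proj E mB.
have : 0 <= inner (E B x) x.
  by rewrite -idemE selfE -sqr_norm_inner exprn_ge0.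
by rewrite lecE => /andP[].
Qed.

Let mu_sigma_additive : semi_sigma_additive mu.
Proof.
move=> F mF tF mUF; rewrite (muE mUF).
rewrite (_ : (fun n => _) = (fun n =>
   (complex.Re (inner (\sum_(0 <= k < n) E (F k) x) x))%:E)); last first.
  apply/funext => n; rewrite linear_sumlz raddf_sum /= -sumEFin.
  by apply: eq_bigr => k _; rewrite muE.
apply/fine_cvgP; split; first exact: nearW.
apply/cvgrPdist_le => e e0.
have x10 : 0 < `|x| + 1 :> R[i] by rewrite ltr_wpDl.
have d0 : 0 < e%:C / (`|x| + 1) by rewrite divr_gt0// ltcR.
have /cvgrPdist_le /(_ _ d0) := @pvm_sigma_additive E F mF tF x.
apply: filterS => n /=; set S := \sum_(0 <= k < n) _ => Sn.
rewrite -raddfB/= -linearBl -lecR (le_trans (normc_ge_Re _))//.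
rewrite (le_trans (inner_CauchySchwarz _ _))//.
rewrite (le_trans (ler_wpM2r (normr_ge0 x) Sn))// mulrAC ler_pdivrMr//.
by apply: ler_wpM2l; rewrite ?lerDl ?lecR ?ltW.
Qed.

HB.instance Definition _ := isMeasure.Build _ _ _ mu
  mu0 mu_ge0 mu_sigma_additive.

Let mu_finite : fin_num_fun mu.
Proof. by move=> B mB; rewrite muE. Qed.

HB.instance Definition _ := Measure_isFinite.Build _ _ _ mu mu_finite.

End scalar_measure_instance.

(* The second clause is the quadratic form of [T = \int l dE(l)]; it
   determines [T], the scalar field being complex. *)
Definition spectral_resolution (T : {linear H -> H}) (E : pvm) :=
  (exists a : R, forall x, E `[- a, a]%classic x = x) /\
  forall x, inner (T x) x = (\int[scalar_measure E x]_l l)%:C.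

Definition maximal_spectral_type (E : pvm) (x : H) :=
  forall y, scalar_measure E y `<< scalar_measure E x.

Definition is_spectral_measure (T : {linear H -> H})
    (mu : {finite_measure set (measurableTypeR R) -> \bar R}) :=
  exists (E : pvm) (x : H),
    [/\ spectral_resolution T E, maximal_spectral_type E x &
        forall B, measurable B -> mu B = scalar_measure E x B].

End spectral_measure.

Section singularity.
Context d (T : measurableType d) (R : realType).
Implicit Types mu nu : {measure set T -> \bar R}.

Definition mutually_singular mu nu :=
  exists N, [/\ measurable N, mu N = 0%E & nu (~` N) = 0%E].

Definition is_singular_part lambda mu nu :=
  mutually_singular nu lambda /\
  exists2 rho : {measure set T -> \bar R}, rho `<< lambda &
    forall B, measurable B -> mu B = (rho B + nu B)%E.

End singularity.

(* Main.v *)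
(* For a Lebesgue-null Borel set [N] carrying [sigma], the projections [E_t(N)]
   of [A_t = A + tK] vanish for almost every [t]. This gives the theorem, and it
   suffices that [E_t(N) K f = 0] for [f] in a countable dense set: the kernel
   of [E_t(N)] is closed, is [A_t]-invariant, and once it contains [Ran K] it is
   [A]-invariant, hence everything by cyclicity.

   The main estimate is the spectral averaging bound
   [\int |E_t(I) K f|^2 dt <= C |I| <K f, f>] for intervals [I]. Let [z = c + iy]
   where [c] is the center of [I] and [y] its half-length, and set [f_0 = f],
   [u_k = (A - iK - z)^-1 K f_k], [f_{k+1} = f_k + 2i u_k]. Then
   [<K f_{k+1}, f_{k+1}> = <K f_k, f_k> - 4y |u_k|^2], so that
   [4y \sum_k |u_k|^2 <= <K f, f>]. With [w = (t + i) / (t - i)], the vectors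
   [s_n(t) = (1 - w) \sum_(k < n) w^k u_k] satisfy
   [(A_t - z) s_n(t) = K f - w^n K f_n] and [K f_n] gets arbitrarily small. As
   [A_t - z] has norm at most [2y] on the range of [E_t(I)], [|E_t(I) K f|] is at
   most [2y |s_n(t)|] up to a small error, and since [t |-> (1 - w) w^k] are
   orthogonal in [L^2(dt)], the integral of [|s_n|^2] is [4 pi \sum_k |u_k|^2]. *)

Require Import Defs.
From HB Require Import structures.
From mathcomp Require Import all_boot all_order all_algebra sesquilinear.
From mathcomp Require Import complex.
From mathcomp Require Import all_classical all_reals all_analysis.
From mathcomp Require Import measurable_realfun.
From mathcomp Require Import ring lra.

Set Implicit Arguments.
Unset Strict Implicit.
Unset Printing Implicit Defensive.

Import Order.TTheory GRing.Theory Num.Theory numFieldNormedType.Exports.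

Local Open Scope classical_set_scope.
Local Open Scope ring_scope.
Local Open Scope complex_scope.

(** * The underlying real inner product *)

Section real_inner_product.
Variables (R : realType) (H : hilbertType R[i]).
Implicit Types x y z : H.

(** Regards [H] as a real Hilbert space in which multiplication by ['i] is an isometry and each [x]
    is orthogonal to ['i *: x]. The estimates thereby become inequalities between reals. *)
Definition rinner x y : R := complex.Re (inner x y).

Definition sqnorm x : R := rinner x x.

Lemma rinnerDl x y z : rinner (x + y) z = rinner x z + rinner y z.
Proof. by rewrite /rinner linearDl raddfD. Qed.

Lemma rinnerBl x y z : rinner (x - y) z = rinner x z - rinner y z.
Proof. by rewrite /rinner linearBl raddfB. Qed.

Lemma inner_conj x y : inner y x = (inner x y)^*.
Proof. by rewrite hermC /= expr0 mul1r. Qed.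

Lemma rinnerC x y : rinner x y = rinner y x.
Proof. by rewrite /rinner (inner_conj y x); case: (inner y x). Qed.

Lemma rinnerDr x y z : rinner z (x + y) = rinner z x + rinner z y.
Proof. by rewrite !(rinnerC z) rinnerDl. Qed.

Lemma rinnerBr x y z : rinner z (x - y) = rinner z x - rinner z y.
Proof. by rewrite !(rinnerC z) rinnerBl. Qed.

Lemma rinner0l x : rinner 0 x = 0.
Proof. by rewrite /rinner linear0l. Qed.

Lemma rinnerZl (c : R[i]) x y : rinner (c *: x) y =
  complex.Re c * rinner x y + complex.Im c * rinner ('i *: x) y.
Proof.
rewrite /rinner !linearZl_LR/=; case: c (inner x y) => a b [u v] /=.
by rewrite mul0r mul1r sub0r mulrN.
Qed.

Lemma rinnerZr (c : R[i]) x y : rinner x (c *: y) =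
  complex.Re c * rinner x y + complex.Im c * rinner x ('i *: y).
Proof. by rewrite !(rinnerC x) rinnerZl. Qed.

Lemma rinnerZRl (c : R) x y : rinner (c%:C *: x) y = c * rinner x y.
Proof. by rewrite rinnerZl/= mul0r addr0. Qed.

Lemma rinnerZRr (c : R) x y : rinner x (c%:C *: y) = c * rinner x y.
Proof. by rewrite rinnerC rinnerZRl rinnerC. Qed.

Lemma rinnerii x y : rinner ('i *: x) ('i *: y) = rinner x y.
Proof.
rewrite /rinner linearZl_LR linearZr_LR /=; case: (inner x y) => u v /=.
by ring.
Qed.

Lemma rinner_il x y : rinner ('i *: x) y = - complex.Im (inner x y).
Proof.
by rewrite /rinner linearZl_LR /=; case: (inner x y) => u v /=; ring.
Qed.

Lemma rinner_ixx x : rinner ('i *: x) x = 0.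
Proof.
by rewrite rinner_il -sqr_norm_inner ger0_Im ?oppr0// exprn_ge0.
Qed.

Lemma rinner_ixC x y : rinner ('i *: x) y = - rinner x ('i *: y).
Proof.
rewrite [in RHS]rinnerC !rinner_il (inner_conj x y).
by case: (inner x y) => u v /=; rewrite opprK.
Qed.

Lemma innerE x : inner x x = (sqnorm x)%:C.
Proof.
rewrite /sqnorm /rinner; have := sqr_norm_inner x.
have : 0 <= `|x| ^+ 2 by rewrite exprn_ge0.
move=> /ger0_Im + h; rewrite h.
by case: (inner x x) => u v /= ->.
Qed.

Lemma sqnormE x : (sqnorm x)%:C = `|x| ^+ 2.
Proof. by rewrite -innerE sqr_norm_inner. Qed.

Lemma sqnorm_ge0 x : 0 <= sqnorm x.
Proof. by rewrite -lecR sqnormE exprn_ge0. Qed.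

Lemma sqnorm_eq0 x : sqnorm x = 0 -> x = 0.
Proof.
move=> h; apply/eqP; rewrite -normr_eq0 -sqrf_eq0 -sqnormE.
by rewrite h.
Qed.

Lemma normE x : `|x| = (Num.sqrt (sqnorm x))%:C.
Proof.
apply/eqP; rewrite -(@eqrXn2 _ 2) ?normr_ge0 ?lecR ?sqrtr_ge0//.
by rewrite -sqnormE -rmorphXn/= sqr_sqrtr ?sqnorm_ge0.
Qed.

Lemma sqnormD x y : sqnorm (x + y) = sqnorm x + sqnorm y + 2 * rinner x y.
Proof.
rewrite /sqnorm rinnerDl !rinnerDr (rinnerC y x); ring.
Qed.

Lemma sqnormN x : sqnorm (- x) = sqnorm x.
Proof. by apply: complexI; rewrite !sqnormE normrN. Qed.

Lemma sqnormB x y : sqnorm (x - y) = sqnorm x + sqnorm y - 2 * rinner x y.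
Proof.
rewrite /sqnorm rinnerBl !rinnerBr (rinnerC y x); ring.
Qed.

Lemma sqnormD_le x y : sqnorm (x + y) <= 2 * (sqnorm x + sqnorm y).
Proof.
by have := sqnorm_ge0 (x - y); rewrite sqnormB sqnormD; lra.
Qed.

Lemma sqnormZ (c : R[i]) x : sqnorm (c *: x) =
  (complex.Re c ^+ 2 + complex.Im c ^+ 2) * sqnorm x.
Proof.
by apply: complexI; rewrite sqnormE normrZ exprMn rmorphM/= add_Re2_Im2 sqnormE.
Qed.

Lemma sqnormZR (c : R) x : sqnorm (c%:C *: x) = c ^+ 2 * sqnorm x.
Proof. by rewrite sqnormZ/= expr0n addr0. Qed.

Lemma sqnormi x : sqnorm ('i *: x) = sqnorm x.
Proof. by rewrite sqnormZ/= expr0n add0r expr1n mul1r. Qed.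

Lemma rinner_eq0 x : (forall y, rinner x y = 0) -> x = 0.
Proof. by move=> h; apply: sqnorm_eq0; exact: h. Qed.

End real_inner_product.

(** * Coercive operators *)

Section bounded_operators.
Variables (R : realType) (H : hilbertType R[i]).
Implicit Types x y z : H.

Lemma bounded_operator_sqnorm (S : {linear H -> H}) : bounded_operator S ->
  exists2 M : R, 0 <= M & forall x, sqnorm (S x) <= M * sqnorm x.
Proof.
move=> [M SM]; exists (complex.Re M ^+ 2) => [|x]; first exact: sqr_ge0.
have := SM x; rewrite !normE lecE => /andP[_].
rewrite [X in _ <= X](_ : _ = complex.Re M * Num.sqrt (sqnorm x)); last first.
  by case: M {SM} => a b /=; rewrite mulr0 subr0.
move=> /= h; rewrite -(sqr_sqrtr (sqnorm_ge0 x)) -(sqr_sqrtr (sqnorm_ge0 (S x))).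
rewrite -exprMn ler_sqr ?nnegrE ?sqrtr_ge0//.
exact: le_trans (sqrtr_ge0 _) h.
Qed.

Lemma norm_lt_sqnorm x (e : R) : 0 < e -> `|x| < e%:C -> sqnorm x < e ^+ 2.
Proof.
move=> e0; rewrite normE ltcR => h.
by rewrite -(sqr_sqrtr (sqnorm_ge0 x)) ltr_sqr ?nnegrE ?sqrtr_ge0// ltW.
Qed.

Lemma cvg_sqnorm_lt (u_ : nat -> H) u (e : R) : u_ @ \oo --> u -> 0 < e ->
  \forall n \near \oo, sqnorm (u - u_ n) < e.
Proof.
move=> /cvgrPdist_lt cu e0.
have se0 : 0 < Num.sqrt e by rewrite sqrtr_gt0.
have := cu (Num.sqrt e)%:C; rewrite ltcR => /(_ se0).
apply: filterS => n /(norm_lt_sqnorm se0).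
by rewrite sqr_sqrtr// ltW.
Qed.

Lemma geometric_cvg (u_ : nat -> H) (k : R) : 0 <= k -> k < 1 ->
  (forall n, sqnorm (u_ n.+2 - u_ n.+1) <= k ^+ 2 * sqnorm (u_ n.+1 - u_ n)) ->
  exists u : H, u_ @ \oo --> u.
Proof.
move=> k0 k1 hu.
pose c := Num.sqrt (sqnorm (u_ 1%N - u_ 0%N)).
have stepE n : `|u_ n.+1 - u_ n| <= (c * k ^+ n)%:C.
  elim: n => [|n ih]; first by rewrite expr0 mulr1 normE.
  move: ih; rewrite !normE !lecR => ih.
  rewrite exprSr mulrA mulrC.
  apply: (@le_trans _ _ (k * Num.sqrt (sqnorm (u_ n.+1 - u_ n)))).
    rewrite -{1}(ger0_norm k0) -sqrtr_sqr -sqrtrM ?sqr_ge0//.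
    by rewrite ler_wsqrtr.
  by rewrite ler_wpM2l.
(* The bound is the sum of the steps [c * k ^+ j] for [n <= j < n + m], in closed form. *)
have dist n m : `|u_ n - u_ (n + m)%N| <= (c * k ^+ n * (1 - k ^+ m) / (1 - k))%:C.
  elim: m => [|m ih]; first by rewrite addn0 subrr normr0 expr0 subrr mulr0 mul0r.
  rewrite -(subrKA (u_ (n + m)%N)) (le_trans (ler_normD _ _))//.
  apply: (le_trans (lerD ih (_ : _ <= (c * k ^+ (n + m))%:C))).
    by rewrite addnS distrC.
  rewrite -rmorphD/= lecR exprD exprS le_eqVlt; apply/orP; left; apply/eqP.
  by field; lra.
apply/cvg_ex/cauchy_cvgP; apply: cauchy_exP => e e0.
have [d d0 de] : exists2 d : R, 0 < d & d%:C = e.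
  exists (complex.Re e); last by rewrite RRe_real// gtr0_real.
  by move: e0; rewrite ltcE => /andP[].
have := @cvg_geometric R (c / (1 - k)) k.
rewrite ger0_norm// => /(_ k1) /cvgrPdist_lt /(_ _ d0)[N _ hN].
exists (u_ N); exists N => // n /= Nn.
rewrite -ball_normE /= -de -(subnKC Nn) (le_lt_trans (dist _ _))// ltcR.
have := hN N (leqnn N); rewrite /= sub0r normrN => /(le_lt_trans _); apply.
have c0 : 0 <= c by exact: sqrtr_ge0.
have ik : 0 <= (1 - k)^-1 by rewrite invr_ge0; lra.
rewrite ger0_norm; last by rewrite !mulr_ge0// exprn_ge0.
rewrite mulrAC (mulrAC c) ler_piMr//; first by rewrite !mulr_ge0// exprn_ge0.
by rewrite gerBl exprn_ge0.
Qed.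

(** A Lax-Milgram argument: for a suitable step [r], the iteration [u - r (S u - g)] is a
    contraction, because [|d - r S d|^2 <= (1 - 2 r a + r^2 M) |d|^2], and its limit solves the
    equation. *)
Lemma coercive_surj (S : {linear H -> H}) (a : R) : 0 < a ->
  bounded_operator S -> (forall x, a * sqnorm x <= rinner (S x) x) ->
  forall g, exists u, S u = g.
Proof.
move=> a0 /bounded_operator_sqnorm[M0 M00 SM0] Sa g.
(* Adding [a ^+ 2] makes [M] positive and [q] non-negative. The step [r = a / M] minimizes the
   contraction factor, with minimum [q]. *)
pose M := M0 + a ^+ 2.
have a20 : 0 < a ^+ 2 by rewrite exprn_gt0.
have M_gt0 : 0 < M by rewrite /M; lra.
have SM x : sqnorm (S x) <= M * sqnorm x.
  apply: (le_trans (SM0 x)); rewrite ler_wpM2r ?sqnorm_ge0// /M; lra.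
pose r := a / M.
pose q := 1 - a ^+ 2 / M.
have q1 : q < 1 by rewrite /q ltrBlDr ltrDl divr_gt0.
have q0 : 0 <= q by rewrite /q subr_ge0 ler_pdivrMr// mul1r /M; lra.
have r0 : 0 < r by rewrite divr_gt0.
have [u_ step] : exists u_ : nat -> H,
    forall n, u_ n.+1 - u_ n = - (r%:C *: (S (u_ n) - g)).
  exists (fun n => iter n (fun u => u - r%:C *: (S u - g)) 0) => n.
  by rewrite iterS addrC addKr.
have [||n|u cu] := @geometric_cvg u_ (Num.sqrt q).
- exact: sqrtr_ge0.
- by rewrite -[ltRHS]sqrtr1 ltr_sqrt.
- rewrite sqr_sqrtr//.
  pose d := u_ n.+1 - u_ n; rewrite -/d.
  have -> : u_ n.+2 - u_ n.+1 = d - r%:C *: S d.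
    rewrite step (_ : S (u_ n.+1) - g = S d + (S (u_ n) - g)).
      by rewrite scalerDr opprD addrC -step.
    by rewrite /d linearB subrKA.
  rewrite sqnormB sqnormZR rinnerZRr rinnerC.
  have h1 := SM d; have h2 := Sa d.
  have : r ^+ 2 * sqnorm (S d) <= r ^+ 2 * (M * sqnorm d).
    by rewrite ler_wpM2l// sqr_ge0.
  have : r * (a * sqnorm d) <= r * rinner (S d) d by rewrite ler_wpM2l// ltW.
  have -> : r ^+ 2 * (M * sqnorm d) = a ^+ 2 / M * sqnorm d.
    by rewrite /r; field; lra.
  have -> : r * (a * sqnorm d) = a ^+ 2 / M * sqnorm d by rewrite /r; ring.
  rewrite /q; lra.
exists u; apply/eqP; rewrite -subr_eq0; apply/eqP/sqnorm_eq0.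
apply/eqP; rewrite eq_le sqnorm_ge0 andbT; apply/ler_addgt0Pr => e e0.
rewrite add0r.
(* The first bound makes [|S (u - u_ N)|^2 <= e / 4]. The second makes the increment
   [u_ N.+1 - u_ N], which is [- r] times the residual, so small that the residual satisfies the
   same bound. *)
have e'0 : 0 < Num.min (e / (4 * M)) (r ^+ 2 * e / 16).
  rewrite lt_min; apply/andP; split; apply: divr_gt0 => //; first lra.
  by rewrite mulr_gt0// exprn_gt0.
have [N _ hN] := cvg_sqnorm_lt cu e'0.
have := hN N (leqnn N); have := hN N.+1 (leqnSn N).
rewrite /= !lt_min => /andP[_ h1] /andP[h2 h3].
have h4 : r ^+ 2 * sqnorm (S (u_ N) - g) <= r ^+ 2 * (e / 4).
  rewrite -sqnormZR -sqnormN -step -(subrKA u) (le_trans (sqnormD_le _ _))//.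
  by rewrite -(opprB u (u_ N.+1)) sqnormN; lra.
rewrite ler_pM2l ?exprn_gt0// in h4.
rewrite -(subrKA (S (u_ N))) -linearB (le_trans (sqnormD_le _ _))//.
have h5 := SM (u - u_ N).
have h6 : M * sqnorm (u - u_ N) <= e / 4.
  rewrite mulrC -ler_pdivlMr// (le_trans (ltW h2))// le_eqVlt; apply/orP; left.
  by apply/eqP; field; lra.
lra.
Qed.

End bounded_operators.

(** * Spectral resolutions *)

Section compactly_supported_integral.
Context (R : realType) (mu : {finite_measure set (measurableTypeR R) -> \bar R}).
Variables u v : R.
Hypothesis mu_supp : mu (~` `[u, v]%classic) = 0%E.

Lemma integrable_id_supp : mu.-integrable setT (EFin \o (@id R)).
Proof.
have mI : measurable (`[u, v]%classic : set (measurableTypeR R)) by [].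
apply/(negligible_integrable _ _ _ mu_supp) => //; first exact: measurableC.
  by apply/measurable_EFinP; exact: measurable_id.
rewrite setTD setCK.
apply: measurable_bounded_integrable => //.
  by rewrite ltey_eq fin_num_measure.
exists (`|u| + `|v|); split; first exact: num_real.
move=> M /ltW uvM x /=; rewrite in_itv/= => /andP[ux xv].
rewrite (le_trans _ uvM)//; have := ler_norm (- u); have := ler_norm v.
have := normr_ge0 u; have := normr_ge0 v; rewrite normrN.
by have [?|?] := ler0P x; lra.
Qed.

Lemma Rintegral_id_supp_bounds :
  u * fine (mu setT) <= \int[mu]_x x <= v * fine (mu setT).
Proof.
have mI : measurable (`[u, v]%classic : set (measurableTypeR R)) by [].
have intI := integrableS measurableT mI (@subsetT _ _) integrable_id_supp.
have muT : mu setT = mu `[u, v]%classic.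
  rewrite -(setUv `[u, v]%classic) measureU//; last 2 first.
  - exact: measurableC.
  - by rewrite setICr.
  by rewrite -[RHS]adde0; congr (_ + _)%E; exact: mu_supp.
have -> : \int[mu]_x x = \int[mu]_(x in `[u, v]) x.
  rewrite /Rintegral (negligible_integral _ _ _ mu_supp)//.
  - by rewrite setTD setCK.
  - exact: measurableC.
  - exact: integrable_id_supp.
have intc r : mu.-integrable `[u, v] (EFin \o (cst r : R -> R)).
  by apply: finite_measure_integrable_cst.
rewrite muT -!Rintegral_cst//; apply/andP; split; apply: le_Rintegral => //.
- exact: intc.
- by move=> x /=; rewrite in_itv/= => /andP[].
- exact: intc.
- by move=> x /=; rewrite in_itv/= => /andP[].
Qed.

End compactly_supported_integral.

Section spectral_resolutions.
Variables (R : realType) (H : hilbertType R[i]).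
Implicit Types x y : H.

Lemma self_adjoint_rinner (T : {linear H -> H}) x y : self_adjoint T ->
  rinner (T x) y = rinner x (T y).
Proof. by rewrite /rinner => ->. Qed.

Section projections.
Variable E : pvm H.
Implicit Types B D : set (measurableTypeR R).

Lemma pvm_idem B x : measurable B -> E B (E B x) = E B x.
Proof. by move=> mB; have [] := pvm_proj E mB. Qed.

Lemma pvm_sym B x y : measurable B -> rinner (E B x) y = rinner x (E B y).
Proof. by move=> mB; apply: self_adjoint_rinner; have [] := pvm_proj E mB. Qed.

Lemma scalar_measureE B x : measurable B ->
  scalar_measure E x B = (sqnorm (E B x))%:E.
Proof.
move=> mB; rewrite /scalar_measure asboolT// -/(rinner _ _).
by rewrite -{1}(pvm_idem _ mB) pvm_sym.
Qed.

Lemma pvm_comm B D x : measurable B -> measurable D -> E B (E D x) = E D (E B x).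
Proof. by move=> mB mD; rewrite -!pvm_setI// setIC. Qed.

Lemma pvm_setIC B x : measurable B -> E B (E (~` B) x) = 0.
Proof.
by move=> mB; rewrite -pvm_setI//; [rewrite setICr pvm_set0|exact: measurableC].
Qed.

Lemma pvm_pythagoras B x : measurable B ->
  sqnorm (E B x) + sqnorm (E (~` B) x) = sqnorm x.
Proof.
move=> mB; have mBC := measurableC mB; apply: EFin_inj.
have := @measureU _ _ _ (scalar_measure E x) _ _ mB mBC (setICr B).
by rewrite /= setUv !scalar_measureE// pvm_setT.
Qed.

(** The two projections of [x] are orthogonal and satisfy Pythagoras, so the squared norm of [x]
    minus both of them expands to 0. *)
Lemma pvm_setC B x : measurable B -> E (~` B) x = x - E B x.
Proof.
move=> mB; have mBC := measurableC mB; apply/eqP; rewrite eq_sym -subr_eq0.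
apply/eqP/sqnorm_eq0.
have proj D : measurable D -> rinner x (E D x) = sqnorm (E D x).
  by move=> mD; rewrite -[in LHS](pvm_idem x mD) -pvm_sym.
have orth : rinner (E B x) (E (~` B) x) = 0.
  by rewrite pvm_sym// pvm_setIC// rinnerC rinner0l.
rewrite !sqnormB rinnerBl orth !proj//.
by have := pvm_pythagoras x mB; lra.
Qed.

Lemma pvm_contraction B x : measurable B -> sqnorm (E B x) <= sqnorm x.
Proof.
by move=> mB; have := pvm_pythagoras x mB; have := sqnorm_ge0 (E (~` B) x); lra.
Qed.

End projections.

Section resolution.
Variables (T : {linear H -> H}) (E : pvm H).
Hypothesis saT : self_adjoint T.
Hypothesis TE : spectral_resolution T E.

Lemma resolution_rinner x : rinner (T x) x = \int[scalar_measure E x]_l l.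
Proof. by rewrite /rinner TE.2. Qed.

Lemma scalar_measure_setC_itv (u v : R) x : E `[u, v]%classic x = x ->
  scalar_measure E x (~` `[u, v]%classic) = 0%E.
Proof.
move=> Ex; have mI : measurable (`[u, v]%classic : set (measurableTypeR R)) by [].
by rewrite scalar_measureE; [rewrite pvm_setC// Ex subrr /sqnorm rinner0l
  |exact: measurableC].
Qed.

Lemma resolution_integrable x :
  (scalar_measure E x).-integrable setT (EFin \o (@id R)).
Proof.
have [[a Ea] _] := TE.
exact: (integrable_id_supp (scalar_measure_setC_itv (Ea x))).
Qed.

Lemma resolution_bounds (u v : R) x : E `[u, v]%classic x = x ->
  u * sqnorm x <= rinner (T x) x <= v * sqnorm x.
Proof.
move=> Ex; rewrite resolution_rinner.
have /= := Rintegral_id_supp_bounds (scalar_measure_setC_itv Ex).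
by rewrite scalar_measureE// pvm_setT.
Qed.

(** Only the quadratic form of [T] is given. Since [E D x] and [E D y] are orthogonal for every [D],
    the scalar measure of [x + y] is the sum of those of [x] and [y]. The form is therefore additive
    on [x + y], which leaves a zero cross term. *)
Lemma resolution_orthogonal B x y : measurable B -> E B x = x -> E B y = 0 ->
  rinner (T x) y = 0.
Proof.
move=> mB Bx By.
have formD : rinner (T (x + y)) (x + y) = rinner (T x) x + rinner (T y) y.
  rewrite !resolution_rinner /Rintegral -fineD; first last.
  - exact: integrable_fin_num (resolution_integrable y).
  - exact: integrable_fin_num (resolution_integrable x).
  congr fine.
  have int z : (scalar_measure E z).-integrable setT EFin.
    exact: (resolution_integrable z).
  rewrite -integral_measure_add ?int//.
  apply: eq_measure_integral => D mD _.
  rewrite [RHS]measure_addE /= !scalar_measureE// linearD sqnormD EFinD.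
  suff -> : rinner (E D x) (E D y) = 0 by rewrite mulr0 adde0.
  by rewrite -Bx pvm_comm// pvm_sym// pvm_comm// By linear0 rinnerC rinner0l.
move: formD; rewrite linearD rinnerDl !rinnerDr (self_adjoint_rinner y)//.
by rewrite (rinnerC y); lra.
Qed.

(** By orthogonality [T] preserves the ranges of the projections of [B] and of its complement;
    decomposing [x] along these two ranges gives commutation. *)
Lemma resolution_comm B x : measurable B -> E B (T x) = T (E B x).
Proof.
move=> mB; have mBC := measurableC mB.
have inv D z : measurable D -> E D z = z -> E (~` D) (T z) = 0.
  move=> mD Dz; apply: rinner_eq0 => y.
  rewrite pvm_sym; last exact: measurableC.
  by apply: (resolution_orthogonal mD) => //; exact: pvm_setIC.
have -> : x = E B x + E (~` B) x by rewrite pvm_setC// subrKC.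
rewrite !linearD /= pvm_idem// pvm_setIC// linear0 addr0.
have := inv _ _ mBC (pvm_idem E x mBC); rewrite setCK => ->; rewrite addr0.
have := inv _ _ mB (pvm_idem E x mB); rewrite pvm_setC// => /eqP.
by rewrite subr_eq0 => /eqP.
Qed.

(* The numerical range of [T - c] on the range of [E `[c - r, c + r]] lies in
   [[-r, r]]; by polarization its norm there is at most [r]. *)
Lemma resolution_itv_sqnorm (c r : R) x : 0 < r ->
  E `[c - r, c + r]%classic x = x -> sqnorm (T x - c%:C *: x) <= r ^+ 2 * sqnorm x.
Proof.
move=> r0 Ex; have mI : measurable (`[c - r, c + r]%classic : set (measurableTypeR R)) by [].
set y := T x - c%:C *: x.
have Ey : E `[c - r, c + r]%classic y = y.
  by rewrite /y linearB linearZ_LR/= resolution_comm// Ex.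
pose S z := T z - c%:C *: z.
have bound z : E `[c - r, c + r]%classic z = z -> `|rinner (S z) z| <= r * sqnorm z.
  move=> /resolution_bounds; rewrite /S rinnerBl rinnerZRl -/(sqnorm z) ler_norml.
  by move=> /andP[? ?]; apply/andP; split; lra.
(* Polarizing with [x + w] and [x - w] gives [2 <S x, w> <= r (|x|^2 + |w|^2)]. The scaling by
   [r^-1] turns this into [|y|^2 <= r^2 |x|^2]. *)
pose w := r^-1%:C *: y.
have Ew : E `[c - r, c + r]%classic w = w by rewrite /w linearZ_LR/= Ey.
have SD : S (x + w) = S x + S w by rewrite /S linearD scalerDr opprD addrACA.
have SB : S (x - w) = S x - S w.
  rewrite /S linearB scalerBr !opprB -!addrA; congr +%R.
  by rewrite addrA [RHS]addrC; congr +%R; exact: addrC.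
have /bound h1 : E `[c - r, c + r]%classic (x + w) = x + w.
  by rewrite linearD Ex Ew.
have /bound h2 : E `[c - r, c + r]%classic (x - w) = x - w.
  by rewrite linearB Ex Ew.
have Ssym u v : rinner (S u) v = rinner (S v) u.
  rewrite /S !rinnerBl !rinnerZRl (self_adjoint_rinner u v saT) (rinnerC u v).
  by rewrite (rinnerC u).
have Sxy : S x = y by [].
clearbody S.
move: h1 h2; rewrite !ler_norml => /andP[_ h1] /andP[h2 _].
move: h1 h2; rewrite SD SB sqnormD sqnormB rinnerBl rinnerDl !rinnerBr !rinnerDr.
rewrite (Ssym w x) => h1 h2.
have h3 : 2 * rinner (S x) w <= r * (sqnorm x + sqnorm w) by lra.
move: h3; rewrite Sxy /w rinnerZRr sqnormZR -/(sqnorm y) => h3.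
have : r * (2 * (r^-1 * sqnorm y)) <= r * (r * (sqnorm x + r^-1 ^+ 2 * sqnorm y)).
  by rewrite ler_pM2l.
have -> : r * (2 * (r^-1 * sqnorm y)) = 2 * sqnorm y by field; lra.
have -> : r * (r * (sqnorm x + r^-1 ^+ 2 * sqnorm y)) =
  r ^+ 2 * sqnorm x + sqnorm y by field; lra.
lra.
Qed.

End resolution.

End spectral_resolutions.

(** * The approximate resolvent of [A + tK] *)

(* [(t + i) / (t - i)] *)
Definition cayley (R : realType) (t : R) : R[i] :=
  ((t ^+ 2 - 1) / (1 + t ^+ 2)) +i* (2 * t / (1 + t ^+ 2)).

Lemma onesqr_gt0 (R : realType) (t : R) : 0 < 1 + t ^+ 2.
Proof. by rewrite ltr_pwDl// sqr_ge0. Qed.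

Lemma cayley_eq (R : realType) (t : R) :
  (1 - cayley t) * (t +i* 1) = - (0 +i* 2) * cayley t.
Proof.
have t0 := lt0r_neq0 (onesqr_gt0 t).
by rewrite /cayley; apply/eqP; rewrite eq_complex /=; apply/andP; split;
  apply/eqP; field.
Qed.

Lemma self_adjoint_addZ (R : realType) (H : hilbertType R[i])
    (A K : {linear H -> H}) (t : R) :
  self_adjoint A -> self_adjoint K -> self_adjoint (A \+ (t%:C \*: K)).
Proof.
move=> saA saK x y /=; rewrite linearDl linearDr linearZl_LR linearZr_LR /=.
by rewrite saA saK -[Num.conj _]/(t%:C^*) conjc_real.
Qed.

Section perturbation.
Variables (R : realType) (H : hilbertType R[i]) (A K : {linear H -> H}).
Hypotheses (bA : bounded_operator A) (saA : self_adjoint A).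
Hypotheses (bK : bounded_operator K) (saK : self_adjoint K).
Hypothesis K0 : nonneg_operator K.
Implicit Types f x : H.

Lemma rinner_i_self_adjoint (T : {linear H -> H}) x : self_adjoint T ->
  rinner ('i *: T x) x = 0.
Proof.
move=> saT; rewrite rinner_il; have := inner_conj (T x) x; rewrite -saT.
by case: (inner (T x) x) => a b /= [] ?; lra.
Qed.

Lemma rinner_nonneg x : 0 <= rinner (K x) x.
Proof. by have := K0 x; rewrite lecE => /andP[]. Qed.

Section approximate_resolvent.
Variables c y : R.
Hypothesis y0 : 0 < y.

(** Multiplied by ['i], the operator becomes [iA + K + (y - ic)]. The real part of its form is
    [<K u, u> + y |u|^2], hence it is coercive with constant [y]. *)
Lemma dissipative_surj g : exists u,
  A u - 'i *: K u - (c +i* y) *: u = g.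
Proof.
pose S : {linear H -> H} :=
  ('i \*: A) \+ (K \+ (((y -i* c) \*: (idfun : {linear H -> H})))).
have [] := @coercive_surj _ _ S y y0 _ _ ('i *: g).
- have [[MA hA] [MK hK]] := (bA, bK).
  exists (MA + (MK + `|y -i* c|)) => x.
  rewrite !mulrDl (le_trans (ler_normD _ _))// lerD//.
    by rewrite normrZ (_ : `|'i| = 1) ?mul1r// normc_def/= expr0n add0r expr1n sqrtr1.
  by rewrite (le_trans (ler_normD _ _))// lerD// normrZ.
- move=> x; rewrite /S /= !rinnerDl rinner_i_self_adjoint// rinnerZl/= rinner_ixx.
  by have := rinner_nonneg x; rewrite -/(sqnorm x); lra.
move=> u; rewrite /S /= => Su; exists u.
apply: (scalerI (_ : 'i != 0)); first by rewrite eq_complex/= oner_eq0 andbF.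
rewrite -Su !scalerBr !scalerA -addrA; congr (_ + _).
rewrite -expr2 sqr_i scaleN1r opprK; congr (_ + _); rewrite -scaleNr; congr (_ *: _).
by apply/eqP; rewrite eq_complex /=; apply/andP; split; apply/eqP; ring.
Qed.

(** In the expansion at [f + 2iu], replace [K f] in the cross term by its expression in [u]. The
    parts from [A] and [c] vanish by self-adjointness, and the cross term [- 4 <K u, u> - 4 y |u|^2]
    cancels the form of [K] at [2iu]. *)
Lemma rinner_dissipative f u : A u - 'i *: K u - (c +i* y) *: u = K f ->
  rinner (K (f + (0 +i* 2) *: u)) (f + (0 +i* 2) *: u) =
  rinner (K f) f - 4 * y * sqnorm u.
Proof.
move=> Ku.
have KfE : rinner (K f) ('i *: u) = - rinner (K u) u - y * sqnorm u.
  have Aiu : rinner (A u) ('i *: u) = 0.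
    by have := rinner_i_self_adjoint u saA; rewrite rinner_ixC; lra.
  have uiu : rinner u ('i *: u) = 0 by rewrite rinnerC rinner_ixx.
  by rewrite -Ku !rinnerBl rinnerii rinnerZl rinnerii Aiu uiu /sqnorm /=; ring.
set v := (0 +i* 2) *: u.
have Kfv : rinner (K f) v = 2 * (- rinner (K u) u - y * sqnorm u).
  by rewrite -KfE rinnerZr/=; ring.
have Kvv : rinner (K v) v = 4 * rinner (K u) u.
  by rewrite /v linearZ_LR [LHS]rinnerZl !(rinnerZr (0 +i* 2)) rinnerii /=; ring.
rewrite linearD rinnerDl !rinnerDr (self_adjoint_rinner v f saK) (rinnerC v).
by rewrite Kfv Kvv; ring.
Qed.

(** Write [A + tK - z = (A - iK - z) + (t + i) K]; by [cayley_eq] the factor [1 - w] turns [t + i]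
    into [- 2i w]. *)
Lemma resolvent_step (t : R) f u : A u - 'i *: K u - (c +i* y) *: u = K f ->
  (1 - cayley t) *: (A u + t%:C *: K u - (c +i* y) *: u) =
  K f - cayley t *: K (f + (0 +i* 2) *: u).
Proof.
move=> Ku.
have -> : A u + t%:C *: K u - (c +i* y) *: u = K f + (t +i* 1) *: K u.
  rewrite -Ku -!addrA; congr (_ + _).
  rewrite [- ('i *: _) + _]addrC -!addrA [LHS]addrC; congr (_ + _).
  rewrite -scaleNr -scalerDl; congr (_ *: _).
  by apply/eqP; rewrite eq_complex /=; apply/andP; split; apply/eqP; ring.
rewrite (linearD K) (linearZ_LR K)/= !scalerDr !scalerA cayley_eq.
by rewrite scalerBl scale1r mulNr scaleNr opprD addrA (mulrC (cayley t)).
Qed.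

(* [u_ n] solves [(A - iK - z) u = K f] for the successive vectors [f_ n]; the
   Cayley transform [1 + 2i (A - iK - z)^-1 K] carrying [f_ n] to [f_ n.+1] is
   a contraction for the form of [K], with defect [4 y |u_ n|^2]. *)
Lemma dissipative_sequence f : exists f_ u_ : nat -> H,
  [/\ forall n, A (u_ n) - 'i *: K (u_ n) - (c +i* y) *: u_ n = K (f_ n),
      forall n (t : R), (1 - cayley t) *: \sum_(k < n) cayley t ^+ k *:
        (A (u_ k) + t%:C *: K (u_ k) - (c +i* y) *: u_ k) =
        K f - cayley t ^+ n *: K (f_ n) &
      forall n, 4 * y * \sum_(k < n) sqnorm (u_ k) <= rinner (K f) f].
Proof.
have [G GE] := choice dissipative_surj.
have [f_ f0 fS] : exists2 f_ : nat -> H, f_ 0%N = f &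
    forall n, f_ n.+1 = f_ n + (0 +i* 2) *: G (K (f_ n)).
  by exists (fun n => iter n (fun g => g + (0 +i* 2) *: G (K g)) f).
pose u_ n := G (K (f_ n)).
have uE n : A (u_ n) - 'i *: K (u_ n) - (c +i* y) *: u_ n = K (f_ n) by exact: GE.
exists f_, u_; split => //.
(* Telescoping: by [resolvent_step] the term of index [k] is [w^k K f_k - w^(k+1) K f_(k+1)]. *)
- elim=> [|n ih] t; first by rewrite big_ord0 scaler0 expr0 scale1r f0 subrr.
  rewrite big_ord_recr/= scalerDr ih scalerA mulrC -scalerA (resolvent_step t (uE n)).
  by rewrite -fS scalerBr scalerA -exprSr addrA subrK.
- move=> n.
  suff : 4 * y * \sum_(k < n) sqnorm (u_ k) = rinner (K f) f - rinner (K (f_ n)) (f_ n).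
    by move=> ->; rewrite gerBl rinner_nonneg.
  elim: n => [|n ih]; first by rewrite big_ord0 mulr0 f0 subrr.
  by rewrite big_ord_recr/= mulrDr ih fS (rinner_dissipative (uE n)); ring.
Qed.

(** Used to bound [|K f_n|^2] by [C |u_n|^2], so that summability of the latter makes [K f_n] small
    for some [n]. *)
Lemma dissipative_sqnorm : exists2 C : R, 0 <= C &
  forall u, sqnorm (A u - 'i *: K u - (c +i* y) *: u) <= C * sqnorm u.
Proof.
have [MA MA0 hA] := bounded_operator_sqnorm bA.
have [MK MK0 hK] := bounded_operator_sqnorm bK.
exists (4 * MA + 4 * MK + 2 * (c ^+ 2 + y ^+ 2)).
  by have := sqr_ge0 c; have := sqr_ge0 y; lra.
move=> u; rewrite (le_trans (sqnormD_le _ _))// sqnormN sqnormZ/=.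
have := sqnormD_le (A u) (- ('i *: K u)); rewrite sqnormN sqnormi.
by have := hA u; have := hK u; lra.
Qed.

End approximate_resolvent.

Lemma sqnorm_cayley (t : R) n x : sqnorm (cayley t ^+ n *: x) = sqnorm x.
Proof.
elim: n x => [|n ih] x; first by rewrite expr0 scale1r.
rewrite exprSr -scalerA ih sqnormZ/= -[RHS]mul1r; congr (_ * _).
by field; exact: lt0r_neq0 (onesqr_gt0 t).
Qed.

(** The choice of [n] and [u_] precedes [t] and [E], so that the bound can be integrated in [t]. The
    constant is [32 = 2 * 4 * 4]: splitting off [w^n K f_n] costs 2,
    [|(T - z) E s|^2 <= 4 y^2 |s|^2], and [|1 - w|^2 = 4 / (1 + t^2)]. *)
Lemma spectral_projection_le (c y e : R) f : 0 < y -> 0 < e ->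
  exists (n : nat) (u_ : nat -> H),
    4 * y * \sum_(k < n) sqnorm (u_ k) <= rinner (K f) f /\
    forall (t : R) (E : pvm H), spectral_resolution (A \+ (t%:C \*: K)) E ->
      sqnorm (E `[c - y, c + y]%classic (K f)) <=
      32 * y ^+ 2 * (sqnorm (\sum_(k < n) cayley t ^+ k *: u_ k) / (1 + t ^+ 2)) + e.
Proof.
move=> y0 e0.
have [f_ [u_ [uE sE uf]]] := dissipative_sequence c y0 f.
have [C C0 hC] := dissipative_sqnorm c y.
have [n hn] : exists n, sqnorm (K (f_ n)) <= e / 2.
  apply: contrapT => /forallNP h.
  have lbu k : e / 2 <= C * sqnorm (u_ k).
    by rewrite (le_trans _ (hC _))// uE leNgt; apply/negP => /ltW; exact: h.
  (* If every [|K f_k|^2] exceeded [e / 2], the bound on [4 y \sum |u_k|^2] would force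
     [4 y e n <= 2 C <K f, f>], which fails for this [n]. *)
  pose n := (Num.bound (2 * C * rinner (K f) f / (4 * y * e))).
  have : n%:R * (e / 2) <= C * \sum_(k < n) sqnorm (u_ k).
    rewrite mulr_sumr -[in leLHS](card_ord n) mulr_natl -sumr_const.
    by apply: ler_sum => i _; exact: lbu.
  have h4 := uf n.
  have := archi_boundP (_ : 0 <= 2 * C * rinner (K f) f / (4 * y * e)).
  rewrite -/n ltr_pdivrMr ?mulr_gt0// => h5 h6.
  have : C * (4 * y * \sum_(k < n) sqnorm (u_ k)) <= C * rinner (K f) f.
    by rewrite ler_wpM2l.
  have : 4 * y * (n%:R * (e / 2)) <= 4 * y * (C * \sum_(k < n) sqnorm (u_ k)).
    by rewrite ler_wpM2l// mulr_ge0// ltW.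
  have : 2 * C * rinner (K f) f < n%:R * (4 * y * e).
    apply: h5; rewrite divr_ge0// ?mulr_ge0 ?rinner_nonneg// ltW//.
  by lra.
exists n, u_; split=> // t E TE.
pose T : {linear H -> H} := A \+ (t%:C \*: K).
have {}TE : spectral_resolution T E by [].
have Tdef x : T x = A x + t%:C *: K x by [].
have saT : self_adjoint T by exact: self_adjoint_addZ.
clearbody T.
have mI : measurable (`[c - y, c + y]%classic : set (measurableTypeR R)) by [].
set I := `[c - y, c + y]%classic in mI *.
set p := \sum_(k < n) cayley t ^+ k *: u_ k.
pose s := (1 - cayley t) *: p.
have TsE : T s - (c +i* y) *: s = K f - cayley t ^+ n *: K (f_ n).
  rewrite -sE /s (linearZ_LR T) scalerA mulrC -scalerA -scalerBr; congr (_ *: _).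
  rewrite /p (linear_sum T) scaler_sumr -sumrB; apply: eq_bigr => k _.
  by rewrite (linearZ_LR T) /= Tdef scalerA mulrC -scalerA -scalerBr.
have ss : sqnorm s = 4 * (sqnorm p / (1 + t ^+ 2)).
  rewrite /s sqnormZ/=; field; exact: lt0r_neq0 (onesqr_gt0 t).
have -> : K f = (T s - (c +i* y) *: s) + cayley t ^+ n *: K (f_ n).
  by rewrite TsE subrK.
rewrite (linearD (E I)) (le_trans (sqnormD_le _ _))// (linearZ_LR (E I))/= sqnorm_cayley.
have h1 := pvm_contraction E (K (f_ n)) mI.
have h2 := pvm_contraction E s mI.
rewrite (linearB (E I)) (linearZ_LR (E I))/= (resolution_comm saT TE)//.
(* On the range of [E I], [T - c] has norm at most [y], and [iy] has norm exactly [y]. *)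
have -> : c +i* y = c%:C + (0 +i* y) by apply/eqP; rewrite eq_complex /= addr0 add0r !eqxx.
rewrite scalerDl opprD addrA.
have h3 := sqnormD_le (T (E I s) - c%:C *: E I s) (- ((0 +i* y) *: E I s)).
have h4 := resolution_itv_sqnorm saT TE y0 (pvm_idem E s mI).
move: h3; rewrite sqnormN sqnormZ/= expr0n add0r => h3.
have h5 : y ^+ 2 * sqnorm (E I s) <= y ^+ 2 * sqnorm s.
  by rewrite ler_wpM2l// sqr_ge0.
by move: h5; rewrite ss => h5; lra.
Qed.

End perturbation.

(** * Orthogonality of the powers of the Cayley transform *)

Section trigonometric_means.
Variable R : realType.
Implicit Types (g : R -> R) (I : R).

(** Encodes [I] as the integral of [g] over [[-pi/2, pi/2]] through an antiderivative: linearity is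
    then algebraic, and [Q \o atan] is an antiderivative of [g (atan t) / (1 + t^2)]. *)
Definition half_circle_integral g I := continuous g /\
  exists2 Q : R -> R, (forall x, is_derive x (1 : R) Q (g x)) &
    Q (pi / 2) - Q (- (pi / 2)) = I.

Lemma half_circle_integralD g1 g2 I1 I2 :
  half_circle_integral g1 I1 -> half_circle_integral g2 I2 ->
  half_circle_integral (fun x => g1 x + g2 x) (I1 + I2).
Proof.
move=> [c1 [Q1 d1 <-]] [c2 [Q2 d2 <-]]; split.
  by move=> x; apply: cvgD; [exact: c1|exact: c2].
exists (fun x => Q1 x + Q2 x) => [x|]; last by ring.
exact: is_deriveD.
Qed.

Lemma half_circle_integralZ g I (k : R) :
  half_circle_integral g I -> half_circle_integral (fun x => k * g x) (k * I).
Proof.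
move=> [c [Q d <-]]; split.
  by move=> x; apply: cvgM; [exact: cvg_cst|exact: c].
exists (fun x => k * Q x) => [x|]; last by ring.
exact: is_deriveZ.
Qed.

Lemma half_circle_integral_sum0 n (g : nat -> R -> R) :
  (forall k, (k < n)%N -> half_circle_integral (g k) 0) ->
  half_circle_integral (fun x => \sum_(k < n) g k x) 0.
Proof.
elim: n => [|n ih] h.
  under eq_fun do rewrite big_ord0.
  split; first by move=> x; exact: cvg_cst.
  by exists (cst 0) => [x|]; [exact: is_derive_cst|rewrite /= subrr].
under eq_fun do rewrite big_ord_recr/=.
have ihn : half_circle_integral (fun x => \sum_(k < n) g k x) 0.
  by apply: ih => k kn; apply: h; exact: ltnW.
by have := half_circle_integralD ihn (h n (ltnSn n)); rewrite addr0.
Qed.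

Lemma half_circle_integral_cst (k : R) : half_circle_integral (cst k) (k * pi).
Proof.
split; first by move=> x; exact: cvg_cst.
exists (fun x => k * x) => [x|]; last by field.
have := is_deriveZ k (is_derive_id x (1 : R)); rewrite /GRing.scale/= mulr1.
exact.
Qed.

Lemma sin_pi_natr n : sin (n%:R * pi : R) = 0.
Proof.
elim: n => [|n ih]; first by rewrite mul0r sin0.
by rewrite -natr1 mulrDl mul1r sinDpi ih oppr0.
Qed.

Lemma half_circle_integral_cos j : (0 < j)%N ->
  half_circle_integral (fun x => cos (j%:R * 2 * x)) 0.
Proof.
move=> j0; have j0' : (j%:R : R) != 0 by rewrite pnatr_eq0 -lt0n.
split.
  move=> x; apply: continuous_comp; first exact: mulrl_continuous.
  exact: continuous_cos.
exists (fun x => (j%:R * 2)^-1 * sin (j%:R * 2 * x)) => [x|].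
  have d : is_derive x (1 : R) (fun x => j%:R * 2 * x) (j%:R * 2 * 1) by exact: is_deriveZ.
  by apply: is_derive_eq; rewrite /GRing.scale/=; field; exact: j0'.
rewrite mulrN sinN (_ : j%:R * 2 * (pi / 2) = j%:R * pi) ?sin_pi_natr; last by field.
by rewrite oppr0 mulr0 subrr.
Qed.

Lemma half_circle_integral_sin j : (0 < j)%N ->
  half_circle_integral (fun x => sin (j%:R * 2 * x)) 0.
Proof.
move=> j0; have j0' : (j%:R : R) != 0 by rewrite pnatr_eq0 -lt0n.
split.
  move=> x; apply: continuous_comp; first exact: mulrl_continuous.
  exact: continuous_sin.
exists (fun x => - (j%:R * 2)^-1 * cos (j%:R * 2 * x)) => [x|].
  have d : is_derive x (1 : R) (fun x => j%:R * 2 * x) (j%:R * 2 * 1) by exact: is_deriveZ.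
  by apply: is_derive_eq; rewrite /GRing.scale/=; field; exact: j0'.
by rewrite mulrN cosN subrr.
Qed.

(** De Moivre's formula for [cayley t = - exp (- 2i atan t)]. *)
Lemma cayley_exp (t : R) n : cayley t ^+ n =
  ((-1) ^+ n * cos (n%:R * 2 * atan t)) +i* (- ((-1) ^+ n * sin (n%:R * 2 * atan t))).
Proof.
have cayleyE : cayley t = (- cos (2 * atan t)) +i* sin (2 * atan t).
  have c0 : cos (atan t) != 0 by rewrite cos_atan invr_eq0 sqrtr_eq0 -ltNge onesqr_gt0.
  have sE : sin (atan t) = t * cos (atan t) by rewrite -{2}(atanK t) /tan divfK.
  have c2 : cos (atan t) ^+ 2 = (1 + t ^+ 2)^-1.
    by rewrite cos_atan exprVn sqr_sqrtr// ltW// onesqr_gt0.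
  have t0 := lt0r_neq0 (onesqr_gt0 t).
  rewrite mulr_natl mulr2n sinD cosD sE /cayley -c2.
  by apply/eqP; rewrite eq_complex/=; apply/andP; split; apply/eqP; ring.
elim: n => [|n ih].
  by rewrite !expr0 !mul0r cos0 sin0 mulr1 mulr0 oppr0.
have -> : n.+1%:R * 2 * atan t = n%:R * 2 * atan t + 2 * atan t.
  by rewrite -[n.+1%:R]natr1; ring.
rewrite exprS ih cayleyE (cosD (n%:R * _ * _)) (sinD (n%:R * _ * _)).
apply/eqP; rewrite eq_complex/= exprS.
by apply/andP; split; apply/eqP; ring.
Qed.

Lemma continuous_atan_weight g : continuous g ->
  continuous (fun t => g (atan t) / (1 + t ^+ 2)).
Proof.
move=> cg t; apply: cvgM.
  by apply: continuous_comp; [exact: continuous_atan|exact: cg].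
apply: cvgV; first exact: lt0r_neq0 (onesqr_gt0 t).
by apply: cvgD; [exact: cvg_cst|exact: exprn_continuous].
Qed.

(** The substitution [x = atan t] gives [Q (atan m) - Q (atan (- m))], and a non-negative [g] makes
    [Q] monotone up to the endpoints. *)
Lemma half_circle_integral_ge0 g I (m : R) : 0 < m -> half_circle_integral g I ->
  (forall t, 0 <= g (atan t)) ->
  (\int[lebesgue_measure]_(t in `[(- m)%R, m]) (g (atan t) / (1 + t ^+ 2))%R%:E <= I%:E)%E.
Proof.
move=> m0 [cg [Q dQ <-]] g0.
pose F t := Q (atan t).
have dF (t : R) : is_derive t (1 : R) F (g (atan t) / (1 + t ^+ 2)).
  by apply: is_derive1_comp; exact: dQ.
have dFt t : derivable F t 1 by have := dF t => -[].
have cF : continuous F.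
  by move=> t; apply: differentiable_continuous; exact/derivable1_diffP.
have cf := continuous_atan_weight cg.
rewrite (@continuous_FTC2 _ _ F); first last.
- by move=> t _; rewrite derive1E derive_val.
- split => //; [exact/cvg_at_right_filter/cF|exact/cvg_at_left_filter/cF].
- exact: continuous_subspaceT.
- lra.
have pi20 : - (pi / 2) <= pi / 2 :> R by have := @pi_gt0 R; lra.
have dQx x : derivable Q x 1 by have := dQ x => -[].
have cQ : continuous Q.
  by move=> t; apply: differentiable_continuous; exact/derivable1_diffP.
have ndQ : {in `[- (pi / 2), pi / 2]%R &, {homo Q : x y / x <= y}}.
  apply: ger0_derive1_le => //; last exact: continuous_subspaceT.
  (* Positivity is known only at values of [atan]; an interior point is [atan (tan x)]. *)
  move=> x xpi; rewrite derive1E derive_val -(tanK xpi); exact: g0.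
have atan_in t : atan t \in `[- (pi / 2), pi / 2]%R.
  by rewrite in_itv/= (ltW (atan_gtNpi2 _)) (ltW (atan_ltpi2 _)).
have pi2_in : pi / 2 \in `[- (pi / 2), pi / 2 : R]%R by rewrite in_itv/= lexx pi20.
have Npi2_in : - (pi / 2) \in `[- (pi / 2), pi / 2 : R]%R by rewrite in_itv/= lexx pi20.
rewrite -EFinB lee_fin /F lerB// ndQ ?atan_in//.
  exact: ltW (atan_ltpi2 _).
exact: ltW (atan_gtNpi2 _).
Qed.

End trigonometric_means.

Section parseval.
Variables (R : realType) (H : hilbertType R[i]).

Lemma rinner_unimodular (c : R[i]) (x y : H) :
  complex.Re c ^+ 2 + complex.Im c ^+ 2 = 1 ->
  rinner (c *: x) (c *: y) = rinner x y.
Proof.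
move=> c1; rewrite rinnerZl !(rinnerZr c) rinnerii rinner_ixC -[RHS]mul1r -c1.
ring.
Qed.

Lemma rinner_cayley (t : R) n (x y : H) :
  rinner (cayley t ^+ n *: x) (cayley t ^+ n *: y) = rinner x y.
Proof.
elim: n x y => [|n ih] x y; first by rewrite expr0 !scale1r.
rewrite exprSr -!scalerA ih rinner_unimodular//=.
by field; exact: lt0r_neq0 (onesqr_gt0 t).
Qed.

(** Parseval by induction on [n]: the new diagonal term is constant in [t], and the new cross terms
    are combinations of [cos] and [sin] of non-zero multiples of [2 atan t], with integral 0. *)
Lemma cayley_sum_sqnorm n (u_ : nat -> H) : exists2 g : R -> R,
  half_circle_integral g ((\sum_(k < n) sqnorm (u_ k)) * pi) &
  forall t : R, sqnorm (\sum_(k < n) cayley t ^+ k *: u_ k) = g (atan t).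
Proof.
elim: n => [|n [g hg gE]].
  exists (cst 0); first by rewrite big_ord0; exact: half_circle_integral_cst.
  by move=> t; rewrite big_ord0 /sqnorm rinner0l.
(* As [cayley t] is unimodular, [<w^k u_k, w^n u_n> = <u_k, w^(n-k) u_n>]; [h k] is twice its real
   part. *)
pose h k x := 2 * ((-1) ^+ (n - k) * rinner (u_ k) (u_ n)) * cos ((n - k)%:R * 2 * x)
  + 2 * (- (-1) ^+ (n - k) * rinner (u_ k) ('i *: u_ n)) * sin ((n - k)%:R * 2 * x).
have hh : half_circle_integral (fun x => \sum_(k < n) h k x) 0.
  apply: half_circle_integral_sum0 => k kn; rewrite /h.
  have nk : (0 < n - k)%N by rewrite subn_gt0.
  have h1 := half_circle_integralZ (2 * ((-1) ^+ (n - k) * rinner (u_ k) (u_ n)))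
    (half_circle_integral_cos R nk).
  have h2 := half_circle_integralZ (2 * (- (-1) ^+ (n - k) * rinner (u_ k) ('i *: u_ n)))
    (half_circle_integral_sin R nk).
  by have := half_circle_integralD h1 h2; rewrite !mulr0 addr0.
exists (fun x => (g x + cst (sqnorm (u_ n)) x) + \sum_(k < n) h k x).
  rewrite big_ord_recr/= mulrDl -[X in half_circle_integral _ X]addr0.
  apply: half_circle_integralD => //; apply: half_circle_integralD => //.
  exact: half_circle_integral_cst.
move=> t; rewrite big_ord_recr/= sqnormD gE sqnorm_cayley; congr (_ + _).
rewrite /rinner linear_sumlz raddf_sum/= mulr_sumr; apply: eq_bigr => -[k kn] _ /=.
rewrite -/(rinner _ _) -(subnKC (ltnW kn)) exprD -scalerA rinner_cayley subnKC; last exact: ltnW.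
by rewrite rinnerZr cayley_exp /h /=; ring.
Qed.

Lemma cayley_sum_integral (m : R) n (u_ : nat -> H) : 0 < m ->
  (\int[lebesgue_measure]_(t in `[(- m)%R, m])
    (sqnorm (\sum_(k < n) cayley t ^+ k *: u_ k) / (1 + t ^+ 2))%R%:E <=
   ((\sum_(k < n) sqnorm (u_ k)) * pi)%R%:E)%E.
Proof.
move=> m0; have [g hg gE] := cayley_sum_sqnorm n u_.
under eq_integral do rewrite gE.
by apply: half_circle_integral_ge0 => // t; rewrite -gE sqnorm_ge0.
Qed.

Lemma cayley_sum_measurable n (u_ : nat -> H) : measurable_fun setT
  (fun t : R => sqnorm (\sum_(k < n) cayley t ^+ k *: u_ k) / (1 + t ^+ 2)).
Proof.
have [g [cg _] gE] := cayley_sum_sqnorm n u_.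
under eq_fun do rewrite gE.
exact: continuous_measurable_fun (continuous_atan_weight cg).
Qed.

End parseval.

(** * Null sets and spectral averaging *)

Section null_sets.
Variable R : realType.
Local Open Scope ereal_scope.

Lemma null_set_cover (N : set (measurableTypeR R)) (e : R) :
  lebesgue_measure N = 0 -> (0 < e)%R ->
  exists c_ y_ : nat -> R, [/\ forall k, (0 < y_ k)%R,
    N `<=` \bigcup_k `[(c_ k - y_ k)%R, (c_ k + y_ k)%R]%classic &
    \sum_(k <oo) (y_ k)%:E <= e%:E].
Proof.
move=> N0 e0; have e20 : (0 < e / 2)%R by rewrite divr_gt0.
have /ereal_inf_lt[z [/= M [mM NM] Mz ze]] : lebesgue_measure N < (e / 2)%:E.
  by rewrite N0 lte_fin.
have h k : exists p : R * R, [/\ (0 < p.2)%R,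
    M k `<=` `[(p.1 - p.2)%R, (p.1 + p.2)%R]%classic &
    p.2%:E <= wlength idfun (M k) + (e / 2 / (2 ^ k.+1)%:R)%:E].
  have ek0 : (0 < e / 2 / (2 ^ k.+1)%:R)%R by rewrite divr_gt0// ltr0n expn_gt0.
  have /ocitvP[->|[[a b] /= ab ->]] : ocitv (M k) by exact: mM.
    (* An empty member of the cover still needs a positive half-length, paid for by the slack. *)
    exists (0, e / 2 / (2 ^ k.+1)%:R)%R; split => //=.
    by rewrite wlength0 add0e.
  (* The full length serves as half-length, so that the sum is bounded directly by the lengths of
     the cover. *)
  exists ((a + b) / 2, b - a)%R; split => /=; first by rewrite subr_gt0.
    move=> x /=; rewrite !in_itv/= => /andP[ax xb].
    by apply/andP; split; lra.
  rewrite wlength_itv /= lte_fin ab -EFinB -EFinD lee_fin; lra.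
have [p hp] := choice h.
exists (fun k => (p k).1), (fun k => (p k).2); split.
- by move=> k; have [] := hp k.
- by move=> x /NM[k _ Mx]; exists k => //; have [_ + _] := hp k; apply.
- apply: (@le_trans _ _ (\sum_(k <oo) (wlength idfun (M k) + (e / 2 / (2 ^ k.+1)%:R)%:E))).
    apply: lee_nneseries => k _; last by have [] := hp k.
    by move=> _; have [/ltW] := hp k.
  apply: le_trans (epsilon_trick _ _ (ltW e20)) _.
    by move=> k; exact: wlength_ge0.
  by rewrite Mz [in leRHS](splitr e) EFinD leeD2r// ltW.
Qed.

(** A Borel-Cantelli argument through measurable majorants, the exceptional set not being assumed
    measurable. Majorants with integrals at most [2^-(j+1)] have an integrable sum, finite almost
    everywhere, while at an exceptional [t] every term is at least [r > 0]. *)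
Lemma negligible_majorants (D : set (measurableTypeR R))
    (P : R -> R -> Prop) : measurable D ->
  (forall e : R, (0 < e)%R -> exists phi : R -> \bar R,
    [/\ measurable_fun D phi, (forall t, 0 <= phi t),
        \int[lebesgue_measure]_(t in D) phi t <= e%:E &
        forall t r, P t r -> r%:E <= phi t]) ->
  lebesgue_measure.-negligible (D `&` [set t | exists2 r, (0 < r)%R & P t r]).
Proof.
move=> mD h.
have e0 j : (0 < 1 / (2 ^ j.+1)%:R :> R)%R by rewrite divr_gt0// ltr0n expn_gt0.
have [phi hphi] := choice (fun j => h _ (e0 j)).
pose S t := \sum_(j <oo) phi j t.
have mS : measurable_fun D S.
  by apply: ge0_emeasurable_sum => [j t _ _|j _]; have [] := hphi j.
have S0 t : 0 <= S t by apply: nneseries_ge0 => j _ _; have [] := hphi j.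
have iS : lebesgue_measure.-integrable D S.
  apply/integrableP; split=> //.
  under eq_integral do rewrite gee0_abs//.
  rewrite /S integral_nneseries//; first last.
  - by move=> j t _; have [] := hphi j.
  - by move=> j; have [] := hphi j.
  apply: (@le_lt_trans _ _ 1%:E); last exact: ltry.
  apply: le_trans (epsilon_trick0 xpredT ler01).
  apply: lee_nneseries => j _; last by have [] := hphi j.
  by move=> _; apply: integral_ge0 => t _; have [] := hphi j.
apply: negligibleS (integrable_ae mD iS) => t [Dt [r r0 Pr]] /=.
move=> /(_ Dt); suff -> : S t = +oo by [].
apply/eqyP => M M0.
apply: (@le_trans _ _ (\sum_(0 <= j < Num.bound (M / r)) phi j t)); last first.
  by apply: nneseries_lim_ge => j _ _; have [] := hphi j.
apply: (@le_trans _ _ (\sum_(0 <= j < Num.bound (M / r)) r%:E)); last first.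
  by apply: lee_sum => j _; have [_ _ _] := hphi j; exact.
rewrite sumEFin lee_fin sumr_const_nat subn0 -mulr_natl -ler_pdivrMr//.
by rewrite ltW// archi_boundP// divr_ge0// ltW.
Qed.

End null_sets.

Section spectral_averaging.
Variables (R : realType) (H : hilbertType R[i]) (A K : {linear H -> H}).
Hypotheses (bA : bounded_operator A) (saA : self_adjoint A).
Hypotheses (bK : bounded_operator K) (saK : self_adjoint K).
Hypothesis K0 : nonneg_operator K.

Lemma spectral_majorant (N : set (measurableTypeR R)) (f : H) (m e : R) :
  measurable N -> lebesgue_measure N = 0%E -> 0 < m -> 0 < e ->
  exists phi : R -> \bar R,
    [/\ measurable_fun `[- m, m]%classic phi, (forall t, (0 <= phi t)%E),
        (\int[lebesgue_measure]_(t in `[(- m)%R, m]) phi t <= e%:E)%E &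
        forall (t : R) (E : pvm H), spectral_resolution (A \+ (t%:C \*: K)) E ->
          ((sqnorm (E N (K f)))%:E <= phi t)%E].
Proof.
move=> mN N0 m0 e0.
have kf0 : 0 <= rinner (K f) f by exact: rinner_nonneg.
have pi0 := @pi_gt0 R.
(* One interval contributes at most [8 pi <K f, f> y_k + 2 m e_k], from [32 y^2 = 8 y * 4 y] and the
   length [2 m] of the window. This is at most [C (y_k + e_k)], and both series sum to at most
   [d = e / (2 C)]. *)
pose C := 8 * rinner (K f) f * pi + 2 * m.
have C0 : 0 < C by rewrite /C ltr_wpDl ?mulr_gt0// !mulr_ge0// ltW.
pose d := e / (2 * C).
have d0 : 0 < d by rewrite divr_gt0// mulr_gt0.
have [c_ [y_ [y0 Ncov ysum]]] := null_set_cover N0 d0.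
pose e_ k := d / (2 ^ k.+1)%:R.
have ek0 k : 0 < e_ k by rewrite divr_gt0// ltr0n expn_gt0.
have h k : exists p : nat * (nat -> H),
    4 * y_ k * \sum_(j < p.1) sqnorm (p.2 j) <= rinner (K f) f /\
    forall (t : R) (E : pvm H), spectral_resolution (A \+ (t%:C \*: K)) E ->
      sqnorm (E `[c_ k - y_ k, c_ k + y_ k]%classic (K f)) <=
      32 * y_ k ^+ 2 * (sqnorm (\sum_(j < p.1) cayley t ^+ j *: p.2 j) / (1 + t ^+ 2)) + e_ k.
  have [n [u_ [h1 h2]]] := spectral_projection_le bA saA bK saK K0 (c_ k) f (y0 k) (ek0 k).
  by exists (n, u_).
have [p hp] := choice h.
pose g k t := sqnorm (\sum_(j < (p k).1) cayley t ^+ j *: (p k).2 j) / (1 + t ^+ 2).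
have g0 k t : 0 <= g k t by rewrite divr_ge0 ?sqnorm_ge0// ltW// onesqr_gt0.
have mg k : measurable_fun `[- m, m]%classic (EFin \o g k).
  apply/measurable_EFinP/(measurable_funS measurableT) => //.
  exact: cayley_sum_measurable.
pose phi k t := ((32 * y_ k ^+ 2)%:E * (g k t)%:E + (e_ k)%:E)%E.
have y20 k : 0 <= 32 * y_ k ^+ 2 by rewrite mulr_ge0// sqr_ge0.
have phi0 k t : (0 <= phi k t)%E.
  rewrite /phi -EFinM -EFinD lee_fin; apply: addr_ge0; last exact: ltW.
  exact: mulr_ge0.
have mphi k : measurable_fun `[- m, m]%classic (phi k).
  by apply: emeasurable_funD => //; exact: measurable_funeM (mg k).
have mI : measurable (`[- m, m]%classic : set (measurableTypeR R)) by [].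
exists (fun t => \sum_(k <oo) phi k t)%E; split.
- by apply: ge0_emeasurable_sum.
- by move=> t; apply: nneseries_ge0 => k _ _; exact: phi0.
- rewrite integral_nneseries//.
  apply: (@le_trans _ _ (\sum_(k <oo) (C%:E * ((y_ k)%:E + (e_ k)%:E)))%E); last first.
    rewrite nneseriesZl; last first.
      by move=> k _; rewrite adde_ge0 ?lee_fin ?ltW.
    have -> : (e%:E = C%:E * (d%:E + d%:E) :> \bar R)%E.
      by rewrite -EFinD -EFinM /d; congr EFin; field; exact: lt0r_neq0.
    rewrite lee_pmul2l ?lte_fin//; apply: le_trans (epsilon_trick _ _ (ltW d0)) _.
      by move=> k; rewrite lee_fin ltW.
    by rewrite leeD2r.
  apply: lee_nneseries => k _; first by move=> _; apply: integral_ge0.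
  rewrite ge0_integralD//; [|by move=> t _; rewrite mule_ge0 ?lee_fin|
    exact: measurable_funeM (mg k)|by move=> t _; rewrite lee_fin ltW].
  rewrite ge0_integralZl_EFin//; [|by move=> t _; rewrite lee_fin|exact: (mg k)].
  rewrite (integral_cst _ mI) /= lebesgue_measure_itv /= lte_fin ifT; last by lra.
  have /= hint := cayley_sum_integral (p k).1 (p k).2 m0.
  have h1 := (hp k).1.
  apply: (@le_trans _ _ ((32 * y_ k ^+ 2)%:E * ((\sum_(j < (p k).1) sqnorm ((p k).2 j)) * pi)%:E
    + (e_ k)%:E * (m%:E - (- m)%:E))%E).
    by rewrite leeD2r// lee_wpmul2l ?lee_fin.
  rewrite -EFinB -!EFinM -!EFinD lee_fin /C.
  have h2 : 8 * y_ k * pi * (4 * y_ k * \sum_(j < (p k).1) sqnorm ((p k).2 j)) <=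
    8 * y_ k * pi * rinner (K f) f.
    by rewrite ler_wpM2l// ltW// !mulr_gt0.
  have h3 : 0 <= rinner (K f) f * pi * e_ k.
    by apply: mulr_ge0; [apply: mulr_ge0 => //|]; exact: ltW.
  have h4 : 0 <= m * y_ k by rewrite ltW// mulr_gt0.
  by lra.
move=> t E TE; rewrite -scalar_measureE//.
(* Countable subadditivity of the scalar measure of [K f] passes from the intervals to [N]. *)
apply: (@le_trans _ _ (\sum_(k <oo) scalar_measure E (K f) `[(c_ k - y_ k)%R, (c_ k + y_ k)%R]%classic)%E).
  by apply: (measure_sigma_subadditive (scalar_measure E (K f))).
apply: lee_nneseries => k _; first by move=> _; exact: measure_ge0.
rewrite scalar_measureE// /phi -EFinM -EFinD lee_fin.
exact: (hp k).2.
Qed.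

Lemma spectral_projection_negligible (N : set (measurableTypeR R)) (f : H) :
  measurable N -> lebesgue_measure N = 0%E ->
  lebesgue_measure.-negligible [set t : R | exists2 E : pvm H,
    spectral_resolution (A \+ (t%:C \*: K)) E & E N (K f) <> 0].
Proof.
move=> mN N0.
pose P t r := exists2 E : pvm H,
  spectral_resolution (A \+ (t%:C \*: K)) E & sqnorm (E N (K f)) = r.
(* The majorants live on bounded windows; these exhaust the line, and [n.+1] keeps each of positive
   length. *)
pose D n : set R := `[- n.+1%:R, n.+1%:R]%classic.
have negD n : lebesgue_measure.-negligible (D n `&` [set t | exists2 r, 0 < r & P t r]).
  apply: negligible_majorants => [|e e0]; first exact: measurable_itv.
  have [phi [mphi phi0 iphi hphi]] := spectral_majorant f mN N0 (ltr0Sn R n) e0.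
  by exists phi; split => // t r [E TE <-]; exact: hphi.
apply: negligibleS (negligible_bigcup negD) => t [E TE ENf].
exists (Num.bound `|t|) => //; split.
  rewrite /D /= in_itv/= -ler_norml (le_trans (ltW (archi_boundP (normr_ge0 t))))//.
  by rewrite ler_nat.
exists (sqnorm (E N (K f))); last by exists E.
by rewrite lt_neqAle sqnorm_ge0 andbT eq_sym; apply/eqP => /sqnorm_eq0.
Qed.

End spectral_averaging.

(** * From the range of [K] to the whole space *)

Lemma closed_ker (R : realType) (H : hilbertType R[i]) (T : {linear H -> H}) :
  bounded_operator T -> closed [set x | T x = 0].
Proof.
move=> /bounded_operator_sqnorm[M M0 TM] x clx; apply: sqnorm_eq0.
apply/eqP; rewrite eq_le sqnorm_ge0 andbT; apply/ler_addgt0Pr => e e0.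
have M10 : 0 < M + 1 by lra.
pose d := Num.sqrt (e / (M + 1)).
have d0 : 0 < d by rewrite sqrtr_gt0 divr_gt0.
have [z [/= Tz]] : [set x | T x = 0] `&` ball x d%:C !=set0.
  by apply: clx; apply: nbhsx_ballx; rewrite ltcR.
rewrite -ball_normE/= => /(norm_lt_sqnorm d0).
rewrite sqr_sqrtr; last by rewrite ltW// divr_gt0.
move=> xz.
rewrite -[T x]subr0 -Tz -linearB add0r (le_trans (TM _))//.
have : (M + 1) * sqnorm (x - z) <= (M + 1) * (e / (M + 1)).
  by rewrite ler_pM2l// ltW.
rewrite mulrCA divff ?mulr1; last exact: lt0r_neq0.
by have := sqnorm_ge0 (x - z); lra.
Qed.

Lemma bounded_operator_comp (R : realType) (H : hilbertType R[i])
    (S T : {linear H -> H}) :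
  bounded_operator S -> bounded_operator T -> bounded_operator (S \o T).
Proof.
move=> /bounded_operator_sqnorm[M M0 SM] /bounded_operator_sqnorm[L L0 TL].
exists (Num.sqrt (M * L))%:C => x; rewrite !normE -rmorphM/= lecR.
rewrite -sqrtrM ?mulr_ge0// ler_wsqrtr//= (le_trans (SM _))// -mulrA.
by rewrite ler_wpM2l.
Qed.

Lemma pvm_bounded (R : realType) (H : hilbertType R[i]) (E : pvm H)
    (B : set (measurableTypeR R)) : measurable B -> bounded_operator (E B).
Proof.
move=> mB; exists 1 => x; rewrite mul1r !normE lecR ler_wsqrtr//.
exact: pvm_contraction.
Qed.

Lemma pvm_null_of_cyclic (R : realType) (H : hilbertType R[i])
    (A K : {linear H -> H}) (t : R) (E : pvm H) (N : set (measurableTypeR R)) :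
  self_adjoint A -> self_adjoint K -> cyclic_set A (range K) ->
  spectral_resolution (A \+ (t%:C \*: K)) E -> measurable N ->
  (forall x, E N (K x) = 0) -> forall x, E N x = 0.
Proof.
move=> saA saK cyc TE mN ENK x.
have saT := self_adjoint_addZ t saA saK.
suff : smallest (closed_invariant_subspace A) (range K) `<=` [set x | E N x = 0].
  by rewrite cyc; apply.
apply: smallest_sub; last by move=> _ [y _ <-]; exact: ENK.
split.
- exact: linear0.
- by move=> a y z /= y0 z0; rewrite linearP y0 z0 scaler0 addr0.
- by apply: closed_ker; exact: pvm_bounded.
- move=> _ [y /= Ey <-].
  (* For [y] in the kernel, [0 = E N (T y) = E N (A y) + t E N (K y)], and the last term vanishes by
     hypothesis. *)
  have /= := resolution_comm saT TE y mN.
  by rewrite Ey (linearD (E N)) (linearZ_LR (E N)) /= ENK !linear0 !addr0.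
Qed.

Theorem theorem1p1 (R : realType) (H : hilbertType R[i]) (A K : {linear H -> H})
    (sigma : {finite_measure set (measurableTypeR R) -> \bar R}) :
  separable_space H ->
  bounded_operator A -> self_adjoint A ->
  bounded_operator K -> self_adjoint K -> nonneg_operator K ->
  mutually_singular sigma lebesgue_measure ->
  cyclic_set A (range K) ->
  {ae lebesgue_measure, forall t : R,
    forall mu : {finite_measure set (measurableTypeR R) -> \bar R},
    is_spectral_measure (A \+ (t%:C \*: K)) mu ->
    mutually_singular mu sigma /\
    forall mu_s : {finite_measure set (measurableTypeR R) -> \bar R},
      is_singular_part lebesgue_measure mu mu_s ->
      mutually_singular mu_s sigma}.
Proof.
move=> [D cD dD] bA saA bK saK K0 [S [mS sS lS]] cyc.
(* [N] is Lebesgue-null and carries [sigma]. *)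
pose N := ~` S; have mN : measurable N by exact: measurableC.
have [code injD] : exists code : H -> nat, {in D &, injective code}.
  by move/countable_injP : cD => -[code /= injD]; exists code.
pose bad f := [set t : R | exists2 E : pvm H,
  spectral_resolution (A \+ (t%:C \*: K)) E & E N (K f) <> 0].
(* Indexing by codes turns the exceptional sets of the countable dense set into a sequence; by
   injectivity [F n] comes from at most one [f]. *)
pose F n := [set t | exists f, [/\ D f, code f = n & bad f t]].
have negF n : lebesgue_measure.-negligible (F n).
  have [[f [Df fn]]|nof] := pselect (exists f, D f /\ code f = n).
    apply: negligibleS (spectral_projection_negligible bA saA bK saK K0 f mN lS).
    move=> t [h [Dh hn]]; suff -> : h = f by [].
    by apply: injD; rewrite ?inE// fn.
  suff -> : F n = set0 by exact: negligible_set0.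
  by rewrite -subset0 => t [f [Df fn _]]; apply: nof; exists f.
apply: negligibleS (negligible_bigcup negF) => t /= nt.
apply: contrapT => nF; apply: nt => mu [E [x [TE _ muE]]].
have ENK z : E N (K z) = 0.
  (* The kernel of [E N \o K] is closed and contains the dense set [D]. *)
  have bEK := bounded_operator_comp (pvm_bounded E mN) bK.
  apply: (closed_ker bEK) => B.
  rewrite nbhsE => -[U [oU Uz] UB].
  have [f [Uf Df]] := dD U (ex_intro _ z Uz) oU.
  exists f; split; last exact: UB.
  apply: contrapT => ENf; apply: nF; exists (code f) => //; exists f; split => //.
  by exists E.
have EN := pvm_null_of_cyclic saA saK cyc TE mN ENK.
have muN : mu N = 0%E.
  by rewrite muE// scalar_measureE// EN /sqnorm rinner0l.
have singular (nu : {finite_measure set (measurableTypeR R) -> \bar R}) :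
    nu N = 0%E -> mutually_singular nu sigma.
  by move=> nuN; exists N; split => //; rewrite /N setCK.
split; first exact: singular.
(* The singular part is dominated by [mu], so it vanishes on [N] as well. *)
move=> mu_s [_ [rho _ muD]]; apply: singular.
apply/eqP; rewrite eq_le measure_ge0 andbT -muN muD// leeDr//.
Qed.
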